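(* Let $\mathcal{C}$ be a cartesian monoidal category and let $(p,g,T)$ be a tagged vwb-lens from $V$ to $S$ in $\mathcal{C}$. If $T$ is change-depending, i.e. $T(s,v,v)=s$, then the induced lens $L((p,g,T))=(P,g)$, where $P(s,v)=p(T(s,g(s),v),v)$, satisfies the getput law: $P(s,g(s))=s$.
   Context: Let $\mathcal{C}$ be a cartesian monoidal category (monoidal product $\otimes=\times$ the categorical product, unit terminal). Equations between morphisms are written with generalized elements (variables), as is standard in a category with finite products. A lens from $V$ to $S$ is a pair of morphisms $(p,g)$ with $p : S\times V\to S$ and $g : S\to V$. The lens laws are putput: $p(p(s,v_1),v_2)=p(s,v_2)$; putget: $g(p(s,v))=v$; getput: $p(s,g(s))=s$. A lens is very-well-behaved (vwb) if it satisfies all three. A tagged vwb-lens from $V$ to $S$ is a triple $(p,g,T)$ where $(p,g)$ is a vwb-lens from $V$ to $S$ and $T : S\times V\times V\to S$ satisfies $p(T(s,v_1,v_2),v_3)=T(p(s,v_3),v_1,v_2)$ and $g(T(s,v_1,v_2))=g(s)$. The tag $T$ is change-depending if $T(s,v,v)=s$. The induced lens is $L((p,g,T)):=(P,g)$ with $P(s,v):=p(T(s,g(s),v),v)$. *)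

(* Defs.v *)
Set Implicit Arguments.
Unset Strict Implicit.
Unset Printing Implicit Defensive.

Record category := Category {
  ob :> Type;
  hom : ob -> ob -> Type;
  idm : forall X, hom X X;
  comp : forall X Y Z, hom Y Z -> hom X Y -> hom X Z;
  comp_idl : forall X Y (f : hom X Y), comp (idm Y) f = f;
  comp_idr : forall X Y (f : hom X Y), comp f (idm X) = f;
  comp_assoc : forall W X Y Z (h : hom Y Z) (g : hom X Y) (f : hom W X),
    comp h (comp g f) = comp (comp h g) f
}.

Declare Scope cat_scope.
Delimit Scope cat_scope with cat.
Local Open Scope cat_scope.

Notation "X ~> Y" := (hom X Y) (at level 70, no associativity) : cat_scope.
Notation "g ∘ f" := (comp g f) (at level 40, left associativity) : cat_scope.

(* The monoidal structure is the one determined by chosen finite products: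
   [prod] is the tensor and [unit] the monoidal unit. The associator, the
   unitors and the action of the tensor on morphisms are not fields, since they
   are forced by the universal properties. *)
Record cartesian_category := CartesianCategory {
  base :> category;
  unit : base;
  term : forall X : base, X ~> unit;
  term_uniq : forall (X : base) (f : X ~> unit), f = term X;
  prod : base -> base -> base;
  fst : forall X Y : base, prod X Y ~> X;
  snd : forall X Y : base, prod X Y ~> Y;
  pair : forall X Y Z : base, Z ~> X -> Z ~> Y -> Z ~> prod X Y;
  fst_pair : forall (X Y Z : base) (f : Z ~> X) (g : Z ~> Y),
    fst X Y ∘ pair f g = f;
  snd_pair : forall (X Y Z : base) (f : Z ~> X) (g : Z ~> Y),
    snd X Y ∘ pair f g = g;
  pair_uniq : forall (X Y Z : base) (f : Z ~> X) (g : Z ~> Y)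
      (h : Z ~> prod X Y),
    fst X Y ∘ h = f -> snd X Y ∘ h = g -> h = pair f g
}.

Arguments fst {c X Y}.
Arguments snd {c X Y}.

Notation "X ⊗ Y" := (prod X Y) (at level 40, left associativity) : cat_scope.
Notation "⟨ f , g , .. , h ⟩" := (pair .. (pair f g) .. h)
  (at level 0) : cat_scope.

(* A variable of type [A] in an equation is a generalized element [X ~> A] at an
   arbitrary stage [X], and [f(a, b)] stands for [f ∘ ⟨a, b⟩]. Triples are
   nested to the left: [S ⊗ V ⊗ V] is [(S ⊗ V) ⊗ V]. *)

Record lens (C : cartesian_category) (V S : C) := Lens {
  put : S ⊗ V ~> S;
  get : S ~> V
}.

Definition putput (C : cartesian_category) (V S : C) (l : lens V S) : Prop :=
  forall (X : C) (s : X ~> S) (v1 v2 : X ~> V),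
    put l ∘ ⟨put l ∘ ⟨s, v1⟩, v2⟩ = put l ∘ ⟨s, v2⟩.

Definition putget (C : cartesian_category) (V S : C) (l : lens V S) : Prop :=
  forall (X : C) (s : X ~> S) (v : X ~> V),
    get l ∘ (put l ∘ ⟨s, v⟩) = v.

Definition getput (C : cartesian_category) (V S : C) (l : lens V S) : Prop :=
  forall (X : C) (s : X ~> S),
    put l ∘ ⟨s, get l ∘ s⟩ = s.

Definition vwb (C : cartesian_category) (V S : C) (l : lens V S) : Prop :=
  putput l /\ putget l /\ getput l.

Record tagged_vwb_lens (C : cartesian_category) (V S : C) := TaggedVwbLens {
  tagged_lens :> lens V S;
  tagged_lens_vwb : vwb tagged_lens;
  tag : S ⊗ V ⊗ V ~> S;
  put_tag : forall (X : C) (s : X ~> S) (v1 v2 v3 : X ~> V),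
    put tagged_lens ∘ ⟨tag ∘ ⟨s, v1, v2⟩, v3⟩
    = tag ∘ ⟨put tagged_lens ∘ ⟨s, v3⟩, v1, v2⟩;
  get_tag : forall (X : C) (s : X ~> S) (v1 v2 : X ~> V),
    get tagged_lens ∘ (tag ∘ ⟨s, v1, v2⟩) = get tagged_lens ∘ s
}.

Definition change_depending (C : cartesian_category) (V S : C)
    (t : tagged_vwb_lens V S) : Prop :=
  forall (X : C) (s : X ~> S) (v : X ~> V), tag t ∘ ⟨s, v, v⟩ = s.

(* [P(s, v) = p(T(s, g(s), v), v)] at the generic element, with [s := fst] and
   [v := snd] at stage [S ⊗ V]. *)
Definition induced_lens (C : cartesian_category) (V S : C)
    (t : tagged_vwb_lens V S) : lens V S :=
  {| put := put t ∘ ⟨tag t ∘ ⟨fst, get t ∘ fst, snd⟩, snd⟩;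
     get := get t |}.

(* Main.v *)
Require Import Defs.

(** On generalized elements the induced put is [P(s, v) = p(T(s, g(s), v), v)].
    At [v := g(s)] the two values that the tag records coincide, so a
    change-depending tag leaves [s] alone, and what remains is [p(s, g(s)) = s],
    the getput law of the underlying lens.

    The induced put is defined as a composite at the generic element of [S ⊗ V];
    [put_induced_lens], which rests on the naturality of pairing [pair_comp],
    turns it into the formula above at an arbitrary stage. *)

Local Open Scope cat_scope.

Lemma pair_comp {C : cartesian_category} {W X Y Z : C}
    (f : Z ~> X) (g : Z ~> Y) (h : W ~> Z) :
  ⟨f, g⟩ ∘ h = ⟨f ∘ h, g ∘ h⟩.
Proof.
  apply pair_uniq; rewrite comp_assoc.
  - now rewrite fst_pair.
  - now rewrite snd_pair.
Qed.

(** Substituting [⟨s, v⟩] for the generic element is precomposition, which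
    passes through every pairing down to the projections. *)
Lemma put_induced_lens {C : cartesian_category} {V S : C}
    (t : tagged_vwb_lens V S) {X : C} (s : X ~> S) (v : X ~> V) :
  put (induced_lens t) ∘ ⟨s, v⟩ = put t ∘ ⟨tag t ∘ ⟨s, get t ∘ s, v⟩, v⟩.
Proof.
  simpl.
  now rewrite <- comp_assoc, pair_comp, <- comp_assoc, !pair_comp,
    <- comp_assoc, fst_pair, snd_pair.
Qed.

Theorem proposition6 (C : cartesian_category) (V S : C)
    (t : tagged_vwb_lens V S) (ht : change_depending t) :
  getput (induced_lens t).
Proof.
  intros X s.
  destruct (tagged_lens_vwb t) as (_ & _ & t_getput).
  rewrite put_induced_lens; simpl.
  rewrite ht.
  apply t_getput.
Qed.
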